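(* Let $(G,\mu)$ be a multiplicative group, let $K \geq 1$, and let $A,B$ be multiplicative sets. Then the following two statements are equivalent, in the sense that if one of them holds for one choice of the implied absolute constants in the $O()$ and $\lesssim$ notation, then the other holds for some (possibly different) choice of absolute constants: (i) $\mu(A\cdot B) \lesssim K^{O(1)} \mu(A)^{1/2}\mu(B)^{1/2}$ (equivalently, $d(A,B^{-1}) \lesssim 1+\log K$). (ii) There exist an $O(K^{O(1)})$-approximate group $H$ with $\mu(H) \lesssim K^{O(1)}\mu(A)^{1/2}\mu(B)^{1/2}$ and a finite set $X$ of cardinality $O(K^{O(1)})$ such that $A \subseteq X\cdot H$ and $B \subseteq H \cdot X$.
   Context: A multiplicative group is a topological group $G$ equipped with a non-negative Radon measure $\mu$ invariant under left translation, right translation and inversion, such that every non-empty open set has positive measure. A multiplicative set is a non-empty open precompact subset of $G$. $A\cdot B=\{ab:a\in A,b\in B\}$, $A^{-1}=\{a^{-1}:a\in A\}$. The Ruzsa distance is $d(A,B)=\log\frac{\mu(A\cdot B^{-1})}{\mu(A)^{1/2}\mu(B)^{1/2}}$. A multiplicative set $H$ is a $K$-approximate group if $H^{-1}=H$ and there is a finite symmetric set $X\subseteq H\cdot H$ with $|X|\le K$ and $H\cdot H\subseteq X\cdot H$. Notation: $X\lesssim K^{O(1)}Y$ means $X\le CK^CY$ for an absolute constant $C$ (independent of $G,A,B,K$); $O(K^{O(1)})$ denotes a quantity at most $CK^C$; $X \lesssim 1+\log K$ means $X\le C(1+\log K)$. *)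

(* Defs.v *)
From HB Require Import structures.
From mathcomp Require Import all_boot all_order all_algebra finmap.
From mathcomp Require Import all_classical all_reals all_analysis.

Set Implicit Arguments.
Unset Strict Implicit.
Unset Printing Implicit Defensive.

Import Order.TTheory GRing.Theory Num.Theory.

Local Open Scope classical_set_scope.
Local Open Scope ring_scope.

HB.mixin Record PreTopologicalGroup_isTopologicalGroup G
    & PointedTopological G & Group G := {
  mulg_continuous : continuous (fun x : G * G => (x.1 * x.2)%g) ;
  invg_continuous : continuous (fun x : G => (x^-1)%g)
}.

(* The distinguished point is there only because measurable types are pointed;
   it is not required to be the unit. No separation axiom is assumed. *)
#[short(type="topologicalGroupType")]
HB.structure Definition TopologicalGroup :=
  {G of PointedTopological G & Group G
      & PreTopologicalGroup_isTopologicalGroup G}.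

Notation borel T := (g_sigma_algebraType (@open T)).

Section MultiplicativeGroup.
Context {R : realType} {G : topologicalGroupType}.
Implicit Types (mu : {measure set (borel G) -> \bar R}) (A B H : set G).

Definition mulset A B : set G := [set (a * b)%g | a in A & b in B].

Definition invset A : set G := [set (a^-1)%g | a in A].

(* Borel measure that is finite on compact sets, outer regular on Borel sets
   and inner regular on open sets. Compact sets are asked to be Borel because
   G need not be Hausdorff. *)
Definition radon mu : Prop :=
  [/\ (forall C : set (borel G),
         compact (C : set G) -> measurable C -> (mu C < +oo)%E),
      (forall E : set (borel G), measurable E ->
         mu E = ereal_inf
           [set mu U | U in [set U : set G | open U /\ E `<=` U]])
    & (forall U : set G, open U ->
         mu U = ereal_sup
           [set mu C | C in [set C : set (borel G) |
              [/\ compact (C : set G), measurable C & C `<=` U]]])].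

Definition multiplicative_group mu : Prop :=
  [/\ radon mu,
      (forall (g : G) (E : set (borel G)), measurable E ->
         mu [set (g * x)%g | x in (E : set G)] = mu E),
      (forall (g : G) (E : set (borel G)), measurable E ->
         mu [set (x * g)%g | x in (E : set G)] = mu E),
      (forall E : set (borel G), measurable E -> mu (invset E) = mu E)
    & (forall U : set G, open U -> U !=set0 -> (0 < mu U)%E)].

Definition multiplicative_set A : Prop :=
  [/\ A !=set0, open A & precompact A].

(* mu(A)^(1/2) mu(B)^(1/2) *)
Definition geom_mean mu A B : \bar R :=
  (mu A `^ 2^-1 * mu B `^ 2^-1)%E.

Definition ruzsa_distance mu A B : \bar R :=
  lne (mu (mulset A (invset B)) / geom_mean mu A B)%E.

Definition approximate_group (K : R) H : Prop :=
  [/\ multiplicative_set H,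
      invset H = H
    & exists X : {fset G},
        [/\ invset [set` X] = [set` X],
            [set` X] `<=` mulset H H,
            (#|` X|%:R : R) <= K
          & mulset H H `<=` mulset [set` X] H]].

(* In the following three statements, C, C1, C2, C3 are the implied constants,
   one for each occurrence of the O() and <~ notations; the quantity
   K^(O(1)) Y with implied constant C is C * K^C * Y. *)

Definition small_product mu (K : R) A B (C : R) : Prop :=
  (mu (mulset A B) <= (C * K `^ C)%:E * geom_mean mu A B)%E.

Definition small_distance mu (K : R) A B (C : R) : Prop :=
  (ruzsa_distance mu A (invset B) <= (C * (1 + ln K))%:E)%E.

Definition approximate_group_control mu (K : R) A B (C1 C2 C3 : R) : Prop :=
  exists (H : set G) (X : {fset G}),
    [/\ approximate_group (C1 * K `^ C1) H,
        (mu H <= (C2 * K `^ C2)%:E * geom_mean mu A B)%E,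
        (#|` X|%:R : R) <= C3 * K `^ C3,
        A `<=` mulset [set` X] H
      & B `<=` mulset H [set` X]].

End MultiplicativeGroup.

(* Main.v *)
(**
The only analytic input is a double counting inequality for open subsets of
G x G, which yields the Ruzsa triangle inequality; the covering lemma is a
maximal packing argument.  If mu(AB) <= k mu(A)^(1/2) mu(B)^(1/2), the triangle
inequality gives mu(A A^-1) <= k^2 mu(A).  Let S be the symmetric open set of
those x for which A and A x overlap in measure at least c k^-4 mu(A).  An energy
argument bounds mu(S) below by a multiple of k^-2 mu(A), and writing each factor
s in S in many ways as a^-1 b with a, b in A bounds mu(A S^n A^-1) by
O_n(k^O(n)) mu(A).  Hence H = S S has small doubling, and the covering lemma
shows that H is an approximate group covering A from the left and B from the
right.  Conversely A B is contained in X H H X.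
*)

Require Import Defs.
From HB Require Import structures.
From mathcomp Require Import all_boot all_order all_algebra finmap.
From mathcomp Require Import all_classical all_reals all_analysis.
From mathcomp Require Import measurable_realfun ring lra.

Set Implicit Arguments.
Unset Strict Implicit.
Unset Printing Implicit Defensive.

Import Order.TTheory GRing.Theory Num.Theory.

Local Open Scope classical_set_scope.
Local Open Scope ring_scope.

(** * Product sets in a topological group *)

Lemma open_preimage (X Y : topologicalType) (f : X -> Y) (A : set Y) :
  continuous f -> open A -> open (f @^-1` A).
Proof. by move=> cf oA; exact: (iffLR (continuousP f) cf). Qed.

(** The tube lemma in filter form. It underlies closedness of products, finite covers by rectangles
    and semicontinuity of slice measures. *)
Lemma near_compact_slice (X Y : topologicalType) (W : set (X * Y)) (x : X)
    (L : set Y) :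
  open W -> compact L -> (forall y, L y -> W (x, y)) ->
  \forall x' \near x, forall y, L y -> W (x', y).
Proof.
move=> oW /compact_near_coveringP cL LW.
apply: (cL X (nbhs x) (fun x' y => W (x', y))) => y Ly.
have /= := open_nbhs_nbhs (conj oW (LW _ Ly)).
case=> -[N1 N2] /= [N1x N2y] sN; exists (N2, N1) => //= -[y' x'] /= [? ?].
exact: sN.
Qed.

Section ProductSets.
Context {G : topologicalGroupType}.
Implicit Types (A B C : set G) (x y : G).

Lemma mulset_mem A B a b : A a -> B b -> mulset A B (a * b)%g.
Proof. by move=> Aa Bb; exists a => //; exists b. Qed.

Lemma invsetE A x : invset A x = A x^-1%g.
Proof.
rewrite propeqE; split=> [[a Aa <-]|Ax]; first by rewrite invgK.
by exists x^-1%g => //; rewrite invgK.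
Qed.

Lemma invset_preimage A : invset A = (fun x => x^-1)%g @^-1` A.
Proof. by apply/funext => x; rewrite invsetE. Qed.

Lemma invsetK A : invset (invset A) = A.
Proof. by apply/funext => x; rewrite !invsetE invgK. Qed.

Lemma mulsetA A B C : mulset A (mulset B C) = mulset (mulset A B) C.
Proof.
apply/seteqP; split=> [_ [a Aa [_ [b Bb [c Cc <-]] <-]]|].
  by rewrite mulgA; apply: mulset_mem => //; exact: mulset_mem.
move=> _ [_ [a Aa [b Bb <-]] [c Cc <-]].
by rewrite -mulgA; apply: mulset_mem => //; exact: mulset_mem.
Qed.

Lemma invset_mul A B : invset (mulset A B) = mulset (invset B) (invset A).
Proof.
apply/seteqP; split=> [_ [_ [a Aa [b Bb <-]] <-]|].
  by rewrite invgM; apply: mulset_mem; rewrite invsetE invgK.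
move=> _ [b Bb [a Aa <-]]; rewrite invsetE invgM.
by apply: mulset_mem; rewrite -invsetE.
Qed.

Lemma mulset_sub A B A' B' :
  A `<=` A' -> B `<=` B' -> mulset A B `<=` mulset A' B'.
Proof. by move=> sA sB _ [a /sA Aa [b /sB Bb <-]]; exact: mulset_mem. Qed.

Lemma mulset1l x A : mulset [set x] A = (fun y => x^-1 * y)%g @^-1` A.
Proof.
apply/seteqP; split=> [_ [_ -> [a Aa <-]]|y Ay]; first by rewrite /= mulKg.
by exists x => //; exists (x^-1 * y)%g => //; rewrite mulVKg.
Qed.

Lemma mulset1r x A : mulset A [set x] = (fun y => y * x^-1)%g @^-1` A.
Proof.
apply/seteqP; split=> [_ [a Aa [_ -> <-]]|y Ay]; first by rewrite /= mulgK.
by exists (y * x^-1)%g => //; exists x => //; rewrite mulgVK.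
Qed.

Lemma continuous_mulg (T : topologicalType) (f g : T -> G) :
  continuous f -> continuous g -> continuous (fun t => f t * g t)%g.
Proof.
move=> cf cg t.
apply: (@cvg_comp _ _ _ (fun t => (f t, g t)) (fun p : G * G => (p.1 * p.2)%g)
  _ (nbhs (f t, g t))).
  by apply: cvg_pair; [exact: cf|exact: cg].
exact: (mulg_continuous (f t, g t)).
Qed.

Lemma continuous_invg (T : topologicalType) (f : T -> G) :
  continuous f -> continuous (fun t => (f t)^-1)%g.
Proof.
move=> cf t; apply: (@cvg_comp _ _ _ f (fun x : G => x^-1)%g); first exact: cf.
exact: (invg_continuous (f t)).
Qed.

Lemma open_mulset1l x A : open A -> open (mulset [set x] A).
Proof.
rewrite mulset1l; apply: open_preimage.
by apply: continuous_mulg => y; [exact: cvg_cst|exact: cvg_id].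
Qed.

Lemma open_mulset1r x A : open A -> open (mulset A [set x]).
Proof.
rewrite mulset1r; apply: open_preimage.
by apply: continuous_mulg => y; [exact: cvg_id|exact: cvg_cst].
Qed.

Lemma open_mulsetl A B : open A -> open (mulset A B).
Proof.
move=> oA; rewrite (_ : mulset A B = \bigcup_(b in B) mulset A [set b]).
  by apply: bigcup_open => b _; exact: open_mulset1r.
apply/seteqP; split=> [_ [a Aa [b Bb <-]]|_ [b Bb [a Aa [_ -> <-]]]].
  by exists b => //; exact: mulset_mem.
exact: mulset_mem.
Qed.

Lemma open_mulsetr A B : open B -> open (mulset A B).
Proof.
move=> oB; rewrite (_ : mulset A B = \bigcup_(a in A) mulset [set a] B).
  by apply: bigcup_open => a _; exact: open_mulset1l.
apply/seteqP; split=> [_ [a Aa [b Bb <-]]|_ [a Aa [_ -> [b Bb <-]]]].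
  by exists a => //; exact: mulset_mem.
exact: mulset_mem.
Qed.

Lemma open_invset A : open A -> open (invset A).
Proof.
rewrite invset_preimage; apply: open_preimage.
by apply: continuous_invg => y; exact: cvg_id.
Qed.

Lemma compact_mulset A B : compact A -> compact B -> compact (mulset A B).
Proof.
move=> cA cB; rewrite (_ : mulset A B =
    (fun p : G * G => p.1 * p.2)%g @` (A `*` B)).
  apply: continuous_compact; last exact: compact_setX.
  by apply: continuous_subspaceT; exact: mulg_continuous.
apply/seteqP; split=> [_ [a Aa [b Bb <-]]|_ [[a b] [/= Aa Bb] <-]].
  by exists (a, b).
exact: mulset_mem.
Qed.

(** For [x] outside [A B], every [a^-1 x] with [a] in [A] avoids [B]; the tube lemma along [A]
    spreads this to a neighbourhood of [x]. Precompactness asks for a closed compact superset, and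
    without Hausdorff separation compactness of a product does not make it closed. *)
Lemma closed_mulset A B : compact A -> closed B -> closed (mulset A B).
Proof.
move=> cA cB; rewrite -openC openE => x nABx.
have oW : open ((fun p : G * G => p.2^-1 * p.1)%g @^-1` (~` B)).
  apply: open_preimage; last by rewrite openC.
  apply: continuous_mulg; last by move=> p; exact: cvg_fst.
  by apply: continuous_invg => p; exact: cvg_snd.
have := near_compact_slice (x := x) oW cA.
move=> near_x; apply: filterS (near_x _).
  by move=> y nB [a Aa [b Bb aby]]; apply: (nB _ Aa); rewrite /= -aby mulKg.
by move=> a Aa /= Bax; apply: nABx; exists a => //; exists (a^-1 * x)%g;
  rewrite ?mulVKg.
Qed.

Lemma precompact_mulset A B :
  precompact A -> precompact B -> precompact (mulset A B).
Proof.
move=> [A' AA' [cA' clA']] [B' BB' [cB' clB']].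
apply: (@precompact_subset _ _ (mulset A' B')).
  by apply: mulset_sub.
rewrite precompact_closed; first exact: compact_mulset.
exact: closed_mulset.
Qed.

Lemma precompact_invset A : precompact A -> precompact (invset A).
Proof.
move=> [A' AA' [cA' clA']]; exists (invset A').
  by move=> x; rewrite !invsetE; exact: AA'.
split.
  apply: continuous_compact cA'; apply: continuous_subspaceT.
  exact: invg_continuous.
rewrite invset_preimage; apply: (@closed_comp _ _ _ _) => // x _.
exact: invg_continuous.
Qed.

(** Meant for finite [A], which is compact but need not be closed when points are not closed. *)
Lemma precompact_mulset_compact A B :
  compact A -> precompact B -> precompact (mulset A B).
Proof.
move=> cA [B' BB' [cB' clB']].
apply: (@precompact_subset _ _ (mulset A B')); first exact: mulset_sub.
rewrite precompact_closed; first exact: compact_mulset.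
exact: closed_mulset.
Qed.

Lemma multiplicative_mulset A B :
  multiplicative_set A -> multiplicative_set B -> multiplicative_set (mulset A B).
Proof.
move=> [[a Aa] oA pA] [[b Bb] oB pB]; split.
- by exists (a * b)%g; exact: mulset_mem.
- exact: open_mulsetl.
- exact: precompact_mulset.
Qed.

Lemma multiplicative_invset A :
  multiplicative_set A -> multiplicative_set (invset A).
Proof.
move=> [[a Aa] oA pA]; split.
- by exists a^-1%g; rewrite invsetE invgK.
- exact: open_invset.
- exact: precompact_invset.
Qed.

Lemma multiplicative_mulset_compact A B : A !=set0 -> compact A ->
  multiplicative_set B -> multiplicative_set (mulset A B).
Proof.
move=> [a Aa] cA [[b Bb] oB pB]; split.
- by exists (a * b)%g; exact: mulset_mem.
- exact: open_mulsetr.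
- exact: precompact_mulset_compact.
Qed.

Lemma multiplicative_sub A B : A !=set0 -> open A -> A `<=` B ->
  multiplicative_set B -> multiplicative_set A.
Proof. by move=> A0 oA AB [_ _ pB]; split => //; exact: precompact_subset pB. Qed.

Lemma compact_fset (X : {fset G}) : compact [set` X].
Proof.
rewrite (_ : [set` X] = \big[setU/set0]_(x <- X) [set x]).
  by apply: bigsetU_compact => x _; exact: compact_set1.
by rewrite -bigcup_fset; apply/seteqP; split=> [x Xx|x [y Xy ->]//]; exists x.
Qed.

Lemma inv_fset (X : {fset G}) : exists Y : {fset G},
  [set` Y] = invset [set` X] /\ #|` Y| = #|` X|.
Proof.
exists ((fun x : G => x^-1)%g @` X)%fset; split; last first.
  by apply/eqP/card_in_imfsetP => x y _ _; exact: invg_inj.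
apply/seteqP; split=> [_ /= /imfsetP[x xX ->]|_ [x xX <-]].
  by rewrite invsetE invgK.
by apply/imfsetP; exists x.
Qed.

Lemma invset_setU A B : invset (A `|` B) = invset A `|` invset B.
Proof. by rewrite /invset image_setU. Qed.

Lemma set_fsetU (X Y : {fset G}) :
  [set` (X `|` Y)%fset] = [set` X] `|` [set` Y].
Proof. by apply/seteqP; split=> x /=; rewrite in_fsetU => /orP. Qed.

Lemma card_fsetU_le (R : numDomainType) (X Y : {fset G}) (r s : R) :
  #|` X|%:R <= r -> #|` Y|%:R <= s -> #|` (X `|` Y)%fset|%:R <= r + s.
Proof.
move=> Xr Ys; apply: le_trans (lerD Xr Ys); rewrite -natrD ler_nat.
exact: leq_card_fsetU.
Qed.

(** The witness is the union of [X] and [X^-1]; the last clause keeps it inside a symmetric set such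
    as [H H]. *)
Lemma symmetric_fset (X : {fset G}) : exists Y : {fset G},
  [/\ invset [set` Y] = [set` Y], [set` X] `<=` [set` Y],
     (#|` Y| <= 2 * #|` X|)%N
   & forall Z, invset Z = Z -> [set` X] `<=` Z -> [set` Y] `<=` Z].
Proof.
have [X' [X'E cX']] := inv_fset X; exists (X `|` X')%fset.
rewrite set_fsetU X'E; split.
- by rewrite invset_setU invsetK setUC.
- by move=> x; left.
- by rewrite mul2n -addnn -[X in (_ <= _ + X)%N]cX' leq_card_fsetU.
- move=> Z ZV XZ x [/XZ//|]; rewrite invsetE => /XZ Zx.
  by rewrite -ZV invsetE.
Qed.

End ProductSets.

(** * Double counting for open sets *)

Section AbstractDoubleCounting.
Local Open Scope ereal_scope.
Context d1 d2 (T1 : measurableType d1) (T2 : measurableType d2) (R : realType).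

(** Tonelli for the indicator of [W]: the lower bound on slices and the upper bound on fibres
    estimate the same product measure in the two orders of integration. *)
Lemma le_integral_double_count (m1 : {sigma_finite_measure set T1 -> \bar R})
    (m2 : {sigma_finite_measure set T2 -> \bar R}) (W : set (T1 * T2))
    (P : set T1) (s : \bar R) (h : T2 -> \bar R) :
  0 <= s -> measurable W -> measurable P ->
  measurable_fun [set: T2] h -> (forall y, 0 <= h y) ->
  (forall x, P x -> s <= m2 (xsection W x)) ->
  (forall y, m1 (ysection W y) <= h y) ->
  s * m1 P <= \int[m2]_y h y.
Proof.
move=> s0 mW mP mh h0 lowerW upperW.
have mW1 := measurable_fun_xsection m2 mW.
have mW2 := measurable_fun_ysection m1 mW.
apply: (@le_trans _ _ (\int[m1]_x m2 (xsection W x))).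
  rewrite -[X in m1 X]setIT -integral_indic// -ge0_integralZl//; last first.
    exact/measurable_EFinP.
  apply: ge0_le_integral => //.
  - by move=> x _; apply: mule_ge0; rewrite ?lee_fin.
  - by apply: measurable_funeM; exact/measurable_EFinP.
  - move=> x _; rewrite indicE; case: (boolP (x \in P)) => [|_].
      by rewrite inE mule1 => /lowerW.
    by rewrite mule0.
rewrite (_ : \int[m1]_x m2 (xsection W x) = \int[m2]_y m1 (ysection W y)).
  by apply: ge0_le_integral.
have := @fubini_tonelli _ _ _ _ _ m1 m2 (EFin \o \1_W).
have -> : (fun x => \int[m2]_y (EFin \o \1_W) (x, y)) = m2 \o xsection W.
  exact: (@indic_fubini_tonelli_FE _ _ _ _ _ m2 W mW).
have -> : (fun y => \int[m1]_x (EFin \o \1_W) (x, y)) = m1 \o ysection W.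
  exact: (@indic_fubini_tonelli_GE _ _ _ _ _ m1 W mW).
apply; last by move=> x; rewrite /= lee_fin.
exact/measurable_EFinP.
Qed.

End AbstractDoubleCounting.

Section RadonDoubleCounting.
Context {R : realType} {G : topologicalGroupType}.
Context (mu : {measure set (borel G) -> \bar R}).

Lemma measurable_open (U : set G) : open U -> measurable (U : set (borel G)).
Proof. exact: sub_gen_smallest. Qed.

Lemma measurable_closed (F : set G) :
  closed F -> measurable (F : set (borel G)).
Proof.
move=> cF; rewrite -[F]setCK; apply: measurableC; apply: measurable_open.
by rewrite openC.
Qed.

Lemma radon_open_gt (U : set G) (r : \bar R) : radon mu -> open U ->
  (r < mu U)%E -> exists C : set (borel G),
    [/\ compact (C : set G), measurable C, C `<=` U & (r < mu C)%E].
Proof.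
move=> [_ _ inner] oU; rewrite (inner _ oU) => /ereal_sup_gt[_ [C [? ? ?] <-]].
by exists C.
Qed.

Lemma radon_precompact_lty (A : set G) : radon mu -> open A -> precompact A ->
  (mu A < +oo)%E.
Proof.
move=> [fin _ _] oA [A' AA' [cA' clA']].
have mA' := measurable_closed clA'.
apply: le_lt_trans (fin _ cA' mA'); apply: le_measure; rewrite ?inE//.
exact: measurable_open.
Qed.

(* An open [W] need not be measurable for the product of the two Borel
   sigma-algebras.  Fubini's theorem is applied to a finite union of rectangles
   inside [W], which inner regularity and the compactness of [C] provide. *)
Lemma compact_double_count (C : set (borel G)) (P Q S : set G)
    (W : set (G * G)) (s t : R) :
  radon mu -> open P -> (mu P < +oo)%E -> open Q -> (mu Q < +oo)%E ->
  open S -> open W -> 0 <= s -> 0 <= t ->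
  compact (C : set G) -> measurable C -> C `<=` P ->
  (forall x, P x -> (s%:E < mu [set y | Q y /\ W (x, y)])%E) ->
  (forall y, Q y -> ~ S y -> (mu [set x | P x /\ W (x, y)] <= t%:E)%E) ->
  (s%:E * mu C <= mu P * mu S + t%:E * mu Q)%E.
Proof.
move=> hmu oP Pfin oQ Qfin oS oW s0 t0 cC mC CP lowerW upperW.
have mP := measurable_open oP; have mQ := measurable_open oQ.
have mS := measurable_open oS.
have oWl x : open [set y | W (x, y)].
  apply: (@open_preimage _ _ (fun y => (x, y)) W) => // y.
  by apply: cvg_pair; [exact: cvg_cst|exact: cvg_id].
have oWr y : open [set x | W (x, y)].
  apply: (@open_preimage _ _ (fun x => (x, y)) W) => // x.
  by apply: cvg_pair; [exact: cvg_id|exact: cvg_cst].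
(* The strict slice bound survives on a compact [L x] inside the slice, by inner regularity; off [C]
   the value is a dummy. *)
have /choice[L LP] (x : G) : exists L : set (borel G), C x ->
    [/\ compact (L : set G), measurable L,
        L `<=` [set y | Q y /\ W (x, y)] & (s%:E < mu L)%E].
  have [Cx|nCx] := pselect (C x); last by exists set0.
  have [|L ?] := radon_open_gt hmu _ (lowerW _ (CP _ Cx)); last by exists L.
  exact: (openI oQ (oWl x)).
(* By the tube lemma [O x] is a neighbourhood of [x] in [C], and [O x] times [L x] lies in [W];
   compactness of [C] leaves finitely many rectangles. *)
pose O (x : G) : set G := interior [set x' | forall y, L x y -> W (x', y)].
have oO x : open (O x) by exact: open_interior.
have CO : C `<=` cover C O.
  move=> x Cx; exists x => //; have [cL _ LW _] := LP _ Cx.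
  by apply: near_compact_slice => // y /LW[].
have [D DC CD] : finite_subset_cover C O C.
  by move: cC; rewrite compact_cover; apply.
pose V : set (borel G * borel G) := \bigcup_(i in [set` D]) (O i `*` L i).
have DLP i : [set` D] i -> _ := fun Di => LP i (set_mem (DC i Di)).
have mV : measurable V.
  apply: fin_bigcup_measurable => // i /DLP[_ mL _ _].
  by apply: measurableX => //; exact: measurable_open.
have VW x y : V (x, y) -> Q y /\ W (x, y).
  move=> [i Di [/= Oix Liy]]; have [_ _ LW _] := DLP _ Di.
  by split; [case: (LW _ Liy)|exact: (interior_subset Oix)].
(* Restriction to [P] and [Q] makes both measures finite, so that Tonelli applies. The bound [h]
   allows a fibre all of [P] over the exceptional set [S], and [t] over the rest of [Q]. *)
pose m1 := mfrestr mP Pfin; pose m2 := mfrestr mQ Qfin.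
pose h (y : borel G) := (mu P * (\1_S y)%:E + t%:E * (\1_Q y)%:E)%E.
have <- : m1 C = mu C by rewrite /m1 /mfrestr /mrestr setIidl.
have H := @le_integral_double_count _ _ _ _ R m1 m2 V C s%:E h.
apply: (le_trans (H _ mV mC _ _ _ _)) => {H} //.
- apply: emeasurable_funD; apply: measurable_funeM; exact/measurable_EFinP.
- by move=> y; rewrite adde_ge0// mule_ge0// lee_fin.
- move=> x Cx; have [i Di Oix] := CD _ Cx; have [_ mL LW /ltW sL] := DLP _ Di.
  apply: (le_trans sL); rewrite /m2 /mfrestr /mrestr; apply: le_measure.
  + by rewrite inE.
  + by rewrite inE; apply: measurableI => //; exact: measurable_xsection.
  + move=> y Ly; split; last by case: (LW _ Ly).
    by rewrite /xsection /= inE; exists i.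
- move=> y; rewrite /m1 /mfrestr /mrestr /h !indicE.
  have mVy : measurable (ysection V y `&` P).
    by apply: measurableI => //; exact: measurable_ysection.
  have VyW : ysection V y `&` P `<=` [set x | P x /\ W (x, y)].
    by move=> x [+ Px]; rewrite /ysection /= inE => /VW[].
  have [Qy|nQy] := boolP (y \in Q); last first.
    rewrite [X in (mu X <= _)%E](_ : _ = set0) ?measure0.
      by rewrite adde_ge0// mule_ge0// lee_fin.
    rewrite -subset0 => x [+ _]; rewrite /ysection /= inE => /VW[+ _].
    by rewrite -inE (negbTE nQy).
  have [Sy|nSy] := boolP (y \in S).
    rewrite !mule1 -[leLHS]adde0; apply: leeD; last by rewrite lee_fin.
    by apply: le_measure; rewrite ?inE// => x [].
  rewrite mule0 mule1 add0e; apply: le_trans (upperW y _ _); last 2 first.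
    by rewrite inE in Qy.
    by move=> /mem_set Sy; rewrite Sy in nSy.
  apply: le_measure; rewrite ?inE//; apply: measurable_open.
  exact: (openI oP (oWr y)).
- have mI (E : set (borel G)) : measurable E ->
      measurable_fun [set: borel G] (fun y => (\1_E y)%:E : \bar R).
    by move=> mE; exact/measurable_EFinP.
  have I0 (E : set (borel G)) (y : borel G) : (0 <= (\1_E y)%:E :> \bar R)%E.
    by rewrite lee_fin.
  rewrite ge0_integralD//;
    do ?[by move=> y _; exact: mule_ge0 | by apply: measurable_funeM; exact: mI].
  rewrite !ge0_integralZl//; do ?exact: mI.
  rewrite !integral_indic// !setIT; apply: leeD; apply: lee_wpmul2l => //;
    rewrite /m2 /mfrestr /mrestr; apply: le_measure; rewrite ?inE//;
    do ?[exact: measurableI | exact: subIsetl].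
Qed.

(** Over the exceptional set [S] fibres are bounded only by [P]. Inner regularity of [P] removes the
    compact set, and a slightly smaller [s] turns the weak slice bound into a strict one. *)
Lemma open_double_count (P Q S : set G) (W : set (G * G)) (s t : R) :
  radon mu -> open P -> (mu P < +oo)%E -> open Q -> (mu Q < +oo)%E ->
  open S -> (mu S < +oo)%E -> open W -> 0 <= t ->
  (forall x, P x -> (s%:E <= mu [set y | Q y /\ W (x, y)])%E) ->
  (forall y, Q y -> ~ S y -> (mu [set x | P x /\ W (x, y)] <= t%:E)%E) ->
  s * fine (mu P) <= fine (mu P) * fine (mu S) + t * fine (mu Q).
Proof.
move=> hmu oP Pfin oQ Qfin oS Sfin oW t0 lowerW upperW.
have fP : mu P \is a fin_num by rewrite ge0_fin_numE.
have fQ : mu Q \is a fin_num by rewrite ge0_fin_numE.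
have fS : mu S \is a fin_num by rewrite ge0_fin_numE.
set r := (_ + _); have r0 : 0 <= r.
  by rewrite /r addr_ge0// mulr_ge0// fine_ge0.
have muP0 : 0 <= fine (mu P) by rewrite fine_ge0.
have rE : (mu P * mu S + t%:E * mu Q = r%:E)%E.
  by rewrite /r EFinD !EFinM !fineK.
rewrite leNgt; apply/negP => lt_r.
have P0 : 0 < fine (mu P).
  rewrite lt_neqAle muP0 andbT; apply/eqP => P0.
  by move: lt_r; rewrite -P0 mulr0 ltNge r0.
(* Room on both sides: [s' < s] gives the strict slice bound, and [r / s'] below the measure of [P]
   gives the compact [C] that leads to a contradiction. *)
have [s' rs' s's] : exists2 s', r / fine (mu P) < s' & s' < s.
  exists ((r / fine (mu P) + s) / 2); first by rewrite midf_lt// ltr_pdivrMr.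
  by rewrite midf_lt// ltr_pdivrMr.
have s'0 : 0 < s' by apply: le_lt_trans rs'; rewrite divr_ge0.
have : ((r / s')%:E < mu P)%E.
  rewrite -[mu P]fineK// lte_fin ltr_pdivrMr// mulrC -ltr_pdivrMr//.
move=> /(radon_open_gt hmu oP)[C [cC mC CP]].
rewrite ltNge => /negP; apply.
have := @compact_double_count C P Q S W s' t hmu oP Pfin oQ Qfin oS oW
  (ltW s'0) t0 cC mC CP _ upperW.
rewrite rE => H; have {}H := H _.
have fC : mu C \is a fin_num.
  rewrite ge0_fin_numE//; apply: le_lt_trans Pfin; apply: le_measure => //.
    by rewrite inE.
  by rewrite inE; exact: measurable_open.
move: H; rewrite -(fineK fC) -EFinM !lee_fin ler_pdivlMr// mulrC; apply.
by move=> x Px; apply: lt_le_trans (lowerW _ Px); rewrite lte_fin.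
Qed.

End RadonDoubleCounting.

(** * Ruzsa calculus *)

Section MultiplicativeGroupVolume.
Context {R : realType} {G : topologicalGroupType}.
Context (mu : {measure set (borel G) -> \bar R}).
Context (hmu : multiplicative_group mu).
Implicit Types (A B C P Q V Y E : set G) (x : G).

(** [fine] sends [+oo] to 0, so comparisons of volumes go through an enclosing set of finite
    measure. *)
Definition vol (E : set G) : R := fine (mu E).

Let hrad : radon mu. Proof. by case: hmu. Qed.

(** Lower semicontinuity of slice measures: a compact part of the slice at [x], of measure above
    [s], stays inside all nearby slices. *)
Lemma open_slice_gt Q (W : set (G * G)) (s : \bar R) : open Q -> open W ->
  open [set x | (s < mu [set y | Q y /\ W (x, y)])%E].
Proof.
have nbhs_open (F : set G) : (forall x, F x -> nbhs x F) -> open F.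
  by move=> nF; rewrite openE.
move=> oQ oW; apply: nbhs_open => x /= sx.
have oWl x' : open [set y | Q y /\ W (x', y)].
  apply: (openI oQ); apply: (@open_preimage _ _ (fun y => (x', y)) W) => // y.
  by apply: cvg_pair; [exact: cvg_cst|exact: cvg_id].
have [C [cC mC CQ sC]] := radon_open_gt hrad (oWl x) sx.
have CW y : C y -> W (x, y) by move=> /CQ[].
have := near_compact_slice oW cC CW; apply: filterS => x' CW'.
apply: (lt_le_trans sC); apply: le_measure; rewrite ?inE//.
  exact: measurable_open.
by move=> y Cy; split; [case: (CQ _ Cy)|exact: CW'].
Qed.

Lemma mu_lty A B : open A -> A `<=` B -> multiplicative_set B ->
  (mu A < +oo)%E.
Proof.
by move=> oA AB [_ _ pB]; apply: radon_precompact_lty => //;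
  exact: precompact_subset pB.
Qed.

Lemma mu_vol A B : open A -> A `<=` B -> multiplicative_set B ->
  mu A = (vol A)%:E.
Proof.
by move=> oA AB mB; rewrite /vol fineK// ge0_fin_numE// (mu_lty oA AB).
Qed.

Lemma vol_ge0 A : 0 <= vol A. Proof. by rewrite fine_ge0. Qed.

Lemma vol_gt0 A : multiplicative_set A -> 0 < vol A.
Proof.
move=> mA; have [A0 oA pA] := mA; rewrite -lte_fin -(mu_vol oA _ mA)//.
by case: hmu => _ _ _ _; apply.
Qed.

Lemma vol_le A B : open A -> A `<=` B -> multiplicative_set B ->
  vol A <= vol B.
Proof.
move=> oA AB mB; have [_ oB _] := mB.
rewrite -lee_fin -(mu_vol oA AB mB) -(mu_vol oB _ mB)//.
by apply: le_measure; rewrite ?inE//; exact: measurable_open.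
Qed.

Lemma mu_mull x A : open A -> mu (mulset [set x] A) = mu A.
Proof.
move=> oA; case: hmu => _ /(_ x A (measurable_open oA)) <- _ _ _; congr (mu _).
apply/seteqP; split=> [_ [_ -> [a Aa <-]]|_ [a Aa <-]]; first by exists a.
exact: mulset_mem.
Qed.

Lemma mu_mulr x A : open A -> mu (mulset A [set x]) = mu A.
Proof.
move=> oA; case: hmu => _ _ /(_ x A (measurable_open oA)) <- _ _; congr (mu _).
apply/seteqP; split=> [_ [a Aa [_ -> <-]]|_ [a Aa <-]]; first by exists a.
exact: mulset_mem.
Qed.

Lemma mu_invset A : open A -> mu (invset A) = mu A.
Proof. by move=> oA; case: hmu => _ _ _ -> //; exact: measurable_open. Qed.

Lemma vol_invset A : open A -> vol (invset A) = vol A.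
Proof. by move=> oA; rewrite /vol mu_invset. Qed.

Lemma vol_le_mull A B : A !=set0 -> open B -> multiplicative_set (mulset A B) ->
  vol B <= vol (mulset A B).
Proof.
move=> [a Aa] oB mAB; rewrite /vol -(mu_mull a oB); apply: vol_le mAB.
  exact: open_mulset1l.
by apply: mulset_sub => // _ ->.
Qed.

Lemma vol_le_mulr A B : B !=set0 -> open A -> multiplicative_set (mulset A B) ->
  vol A <= vol (mulset A B).
Proof.
move=> [b Bb] oA mAB; rewrite /vol -(mu_mulr b oA); apply: vol_le mAB.
  exact: open_mulset1r.
by apply: mulset_sub => // _ ->.
Qed.

Lemma open_mul_preimage (T : topologicalType) (f g : T -> G) V :
  continuous f -> continuous g -> open V -> open [set t | V (f t * g t)%g].
Proof. by move=> cf cg; apply: open_preimage; exact: continuous_mulg. Qed.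

(** Double counting of pairs with [x z^-1] in [V], with empty exceptional set: the fibre over [z]
    lies in [V z], which has the measure of [V] by right invariance. *)
Lemma popular_product P Q V (s : R) :
  multiplicative_set P -> multiplicative_set Q -> multiplicative_set V ->
  (forall x, P x -> exists E, [/\ open E, E `<=` Q,
     (forall z, E z -> V (x * z^-1)%g) & s <= vol E]) ->
  s * vol P <= vol V * vol Q.
Proof.
move=> mP mQ mV popP; have [_ oP _] := mP; have [_ oQ _] := mQ.
have [_ oV _] := mV.
have oW : open [set p : G * G | V (p.1 * p.2^-1)%g].
  apply: open_mul_preimage oV => [p|]; first exact: cvg_fst.
  by apply: continuous_invg => p; exact: cvg_snd.
have := @open_double_count _ _ mu P Q set0 _ s (vol V) hrad oP (mu_lty oP _ mP)
  oQ (mu_lty oQ _ mQ) open0 _ oW (vol_ge0 V).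
rewrite !measure0 mulr0 add0r; apply => //.
- move=> x Px; have [E [oE EQ EV sE]] := popP _ Px.
  rewrite (@le_trans _ _ (vol E)%:E) ?lee_fin// -(mu_vol oE EQ mQ).
  apply: le_measure; rewrite ?inE; [exact: measurable_open| |].
    apply: measurable_open; apply: (openI oQ).
    apply: open_mul_preimage oV => [p|]; first exact: cvg_cst.
    by apply: continuous_invg => p; exact: cvg_id.
  by move=> z Ez; split; [exact: EQ|exact: EV].
- move=> z Qz _; rewrite -(mu_vol oV _ mV)// -(mu_mulr z oV).
  apply: le_measure; rewrite ?inE; last 2 first.
  + apply: measurable_open; exact: open_mulset1r.
  + by move=> x [Px /= Vxz]; rewrite mulset1r.
  apply: measurable_open; apply: (openI oP).
  by apply: open_mul_preimage oV => p; [exact: cvg_id|exact: cvg_cst].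
Qed.

(** The identity [a c = (a b) (b^-1 c)] gives each element of [A C] a family of factorisations
    indexed by [B]. *)
Lemma ruzsa_triangle A B C :
  multiplicative_set A -> multiplicative_set B -> multiplicative_set C ->
  vol B * vol (mulset A C) <=
  vol (mulset A B) * vol (mulset (invset B) C).
Proof.
move=> mA mB mC; have [_ oB _] := mB.
apply: popular_product; do ?exact: multiplicative_mulset.
  by apply: multiplicative_mulset => //; exact: multiplicative_invset.
move=> _ [a Aa [c Cc <-]]; exists (mulset (invset B) [set c]); split.
- by apply: open_mulset1r; exact: open_invset.
- by apply: mulset_sub => // _ ->.
- move=> _ [b' Bb' [_ -> <-]]; rewrite invgM mulgA mulgK.
  by apply: mulset_mem => //; rewrite -invsetE.
- by rewrite /vol mu_mulr ?mu_invset//; exact: open_invset.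
Qed.

(** The intersection of [A] with [A x]; its measure is a convolution, weighing the ways to write [x]
    as [b^-1 a] with [a], [b] in [A]. *)
Definition translate_overlap A x : set G := [set a | A a /\ A (a * x^-1)%g].

(** Strictness makes the set open, by semicontinuity, and forces a non-empty overlap even at
    [t = 0]. *)
Definition popular_translates A (t : R) : set G :=
  [set x | (t%:E < mu (translate_overlap A x))%E].

Lemma open_translate_overlap A x : open A -> open (translate_overlap A x).
Proof.
move=> oA; apply: (openI oA).
by apply: open_mul_preimage oA => p; [exact: cvg_id|exact: cvg_cst].
Qed.

Lemma open_popular_translates A t : open A -> open (popular_translates A t).
Proof.
move=> oA; apply: (@open_slice_gt A [set p | A (p.2 * p.1^-1)%g]) => //.
apply: open_mul_preimage oA => [p|]; first exact: cvg_snd.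
by apply: continuous_invg => p; exact: cvg_fst.
Qed.

Lemma popular_translates_sub A t : 0 <= t ->
  popular_translates A t `<=` mulset (invset A) A.
Proof.
move=> t0 x; rewrite /popular_translates /= => tx.
have [[a [Aa Aax]]|] := pselect (translate_overlap A x !=set0).
  rewrite -[x](mulgVK a) -[(x * a^-1)%g]invgK invgM invgK.
  by apply: mulset_mem => //; rewrite invsetE invgK.
move=> nE; have E0 : translate_overlap A x = set0.
  by rewrite -subset0 => a Ea; apply: nE; exists a.
by move: tx; rewrite E0 measure0 ltNge lee_fin t0.
Qed.

(** Right translation by [x] carries the overlap of [A] with [A x^-1] onto that of [A] with
    [A x]. *)
Lemma popular_translatesV A t : open A ->
  invset (popular_translates A t) = popular_translates A t.
Proof.
move=> oA; apply/funext => x; rewrite invsetE /popular_translates /=.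
congr (_ < _)%E; rewrite -(mu_mulr x (open_translate_overlap _ oA)).
congr (mu _); apply/funext => a; rewrite mulset1r /translate_overlap /= invgK.
by rewrite mulgVK propeqE; split=> -[].
Qed.

(* With [a, b] in [A] and [s = a^-1 b], write [y s c = (y a^-1) (b c)]: each
   overlap provides more than [t] factorisations. *)
Lemma popular_translates_growth A C Y (t : R) : 0 <= t ->
  multiplicative_set A -> multiplicative_set C -> multiplicative_set Y ->
  multiplicative_set (popular_translates A t) ->
  t * vol (mulset (mulset Y (popular_translates A t)) C) <=
  vol (mulset Y (invset A)) * vol (mulset A C).
Proof.
move=> t0 mA mC mY mS; have [_ oA _] := mA.
apply: popular_product.
- by apply: multiplicative_mulset => //; exact: multiplicative_mulset.
- exact: multiplicative_mulset.
- by apply: multiplicative_mulset => //; exact: multiplicative_invset.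
move=> _ [_ [y Yy [s Ss <-]] [c Cc <-]].
have oE := @open_translate_overlap A s oA.
have sub : mulset (translate_overlap A s) [set c] `<=` mulset A C.
  by apply: mulset_sub => [a []|_ ->].
exists (mulset (translate_overlap A s) [set c]); split => //.
- exact: open_mulset1r.
- move=> _ [b [Ab Abs] [_ -> <-]]; rewrite invgM mulgA mulgK -mulgA.
  by apply: mulset_mem => //; rewrite invsetE invgM invgK.
- rewrite -lee_fin -(mu_vol _ sub); last exact: multiplicative_mulset.
    by rewrite mu_mulr// ltW.
  exact: open_mulset1r.
Qed.

(** * Covering by translates *)

Lemma measure_translates (X : {fset G}) B : open B ->
  trivIset [set` X] (fun x => mulset [set x] B) ->
  mu (mulset [set` X] B) = (#|` X|%:R%:E * mu B)%E.
Proof.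
move=> oB tX; rewrite (_ : mulset [set` X] B =
    \bigcup_(x in [set` X]) (mulset [set x] B : set (borel G))).
  rewrite measure_fin_bigcup//; last first.
    by move=> x _; apply: measurable_open; exact: open_mulset1l.
  rewrite fsbig_finite//= set_fsetK.
  rewrite (eq_bigr (fun=> mu B)); last by move=> x _; exact: mu_mull.
  rewrite mule_natl; elim: (enum_fset X) => [|x s IH]; first by rewrite big_nil.
  by rewrite big_cons IH -muleS.
apply/seteqP; split=> [_ [x Xx [b Bb <-]]|_ [x Xx [_ -> [b Bb <-]]]].
  by exists x => //; exact: mulset_mem.
exact: mulset_mem.
Qed.

(** Take a largest [X] in [A] with disjoint translates [x B]. They lie in [A B], which bounds their
    number; by maximality each [a B] meets some [x B], so [a] lies in [x B B^-1]. *)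
Lemma ruzsa_covering A B (M : R) :
  multiplicative_set A -> multiplicative_set B ->
  vol (mulset A B) <= M * vol B ->
  exists X : {fset G}, [/\ [set` X] `<=` A, (#|` X|%:R : R) <= M
    & A `<=` mulset [set` X] (mulset B (invset B))].
Proof.
move=> mA mB AB; have [_ oA _] := mA; have [[b0 Bb0] oB _] := mB.
have mAB := multiplicative_mulset mA mB; have vB := vol_gt0 mB.
pose packing (X : {fset G}) := [set` X] `<=` A /\
  trivIset [set` X] (fun x => mulset [set x] B).
have card_packing X : packing X -> (#|` X|%:R : R) <= M.
  move=> [XA tX]; rewrite -(ler_pM2r vB); apply: le_trans AB.
  rewrite -lee_fin EFinM -(mu_vol oB (@subset_refl _ B) mB).
  rewrite -measure_translates// (mu_vol (B := mulset A B)) ?lee_fin//.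
  - by apply: vol_le => //; [exact: open_mulsetr|exact: mulset_sub].
  - exact: open_mulsetr.
  - exact: mulset_sub.
have [N MN] : exists N : nat, M <= N%:R.
  exists (Num.bound `|M|); apply/ltW/(le_lt_trans (ler_norm M)).
  exact: archi_boundP.
have ex0 : exists n, `[< exists2 X, packing X & #|` X| = n >].
  exists 0%N; apply/asboolP; exists fset0; last by rewrite cardfs0.
  by split=> [x|x y]; rewrite /= inE.
have bnd n : `[< exists2 X, packing X & #|` X| = n >] -> (n <= N)%N.
  move=> /asboolP[X /card_packing XM <-]; rewrite -(ler_nat R).
  exact: le_trans MN.
case: (ex_maxnP ex0 bnd) => n /asboolP[X pX Xn] maxn.
have [XA tX] := pX; exists X; split => //; first exact: card_packing.
move=> a Aa; have [//|naX] := pselect (mulset [set` X] (mulset B (invset B)) a).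
exfalso.
(* Points of [X] are already covered, because the unit lies in [B B^-1]. *)
have naX' : a \notin X.
  apply/negP => aX; apply: naX; exists a => //.
  exists 1%g; last by rewrite mulg1.
  by rewrite -(mulgV b0); apply: mulset_mem => //; rewrite invsetE invgK.
have dis x : x \in X -> mulset [set a] B `&` mulset [set x] B = set0.
  move=> xX; rewrite -subset0 => _ [[_ -> [b Bb <-]] [_ -> [b' Bb' abxb']]].
  apply: naX; rewrite -[a](mulgK b) -abxb' -mulgA.
  by apply: mulset_mem => //; apply: mulset_mem => //; rewrite invsetE invgK.
have : (#|` (a |` X)%fset| <= n)%N.
  apply: maxn; apply/asboolP; exists (a |` X)%fset => //; split.
    by move=> x /=; rewrite !inE => /orP[/eqP->//|]; exact: XA.
  move=> x y /=; rewrite !inE => /orP[/eqP->|xX] /orP[/eqP->|yX] //.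
  - by rewrite dis// => /set0P/eqP.
  - by rewrite setIC dis// => /set0P/eqP.
  - exact: tX.
by rewrite cardfsU1 naX' Xn add1n ltnn.
Qed.

(** * The set of popular translates *)

(* This replaces the additive energy identity.  Popular left translates [T] have
   measure at least [vol A / 2] by double counting in [A * (A A^-1)]; some [a]
   in [A] lies in [y A] for many [y] in [T], forming [D]; then count the pairs
   [(y, c)] in [D * A] with [y^-1 c] in [A], the fibre over [c] being controlled
   by the overlap of [A] with its translate by [c^-1 a]. *)
Lemma vol_popular_translates A (q : R) : multiplicative_set A -> 1 <= q ->
  vol (mulset A (invset A)) <= q * vol A ->
  vol A <= 4 * q * vol (popular_translates A (vol A / (32 * q ^+ 2))).
Proof.
move=> mA q1 AAq; have [_ oA _] := mA.
set t := _ / _; set S := popular_translates A t.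
have q0 : 0 < q by lra.
have v0 := vol_gt0 mA; have v0' := ltW v0.
(* Pairs [(a, y)] with [a] and [y^-1 a] in [A] have total mass [vol A ^ 2], spread over a set of [y]
   of volume at most [q vol A]; [s] is half the resulting lower bound on the average fibre. *)
pose s := vol A / (2 * q).
have sE : vol A = 2 * q * s by rewrite /s; field; rewrite gt_eqF.
have tE : t = s / (16 * q) by rewrite /t sE; field; rewrite gt_eqF.
have s0 : 0 < s by rewrite divr_gt0// mulr_gt0.
have t0 : 0 < t by rewrite tE divr_gt0// mulr_gt0.
have mAA : multiplicative_set (mulset A (invset A)).
  by apply: multiplicative_mulset => //; exact: multiplicative_invset.
have [_ oAA _] := mAA.
have oW : open [set p : G * G | A (p.1^-1 * p.2)%g].
  apply: open_mul_preimage oA => [|p]; last exact: cvg_snd.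
  by apply: continuous_invg => p; exact: cvg_fst.
have oW' : open [set p : G * G | A (p.2^-1 * p.1)%g].
  apply: open_mul_preimage oA => [|p]; last exact: cvg_fst.
  by apply: continuous_invg => p; exact: cvg_snd.
have oWr y : open [set a | A (y^-1 * a)%g].
  by apply: open_mul_preimage oA => [p|p]; [exact: cvg_cst|exact: cvg_id].
have oWl a : open [set y | A (y^-1 * a)%g].
  apply: open_mul_preimage oA => [|p]; last exact: cvg_cst.
  by apply: continuous_invg => p; exact: cvg_id.
pose T := [set y | (s%:E < mu [set a | A a /\ A (y^-1 * a)%g])%E].
have oT : open T by exact: (open_slice_gt _ oA oW).
have TAA : T `<=` mulset A (invset A).
  move=> y; rewrite /T /= => sy.
  have [[a [Aa Aya]]|nE] := pselect ([set a | A a /\ A (y^-1 * a)%g] !=set0).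
    rewrite -[y](mulgK (y^-1 * a)%g) mulVKg.
    by apply: mulset_mem => //; rewrite invsetE invgK.
  have E0 : [set a | A a /\ A (y^-1 * a)%g] = set0.
    by rewrite -subset0 => a Ea; apply: nE; exists a.
  by move: sy; rewrite E0 measure0 ltNge lee_fin ltW.
have finT := mu_lty oT TAA mAA.
have vT : vol A <= 2 * vol T.
  (* Fibres outside [T] contribute at most [s q vol A], half of the total mass. *)
  have := @open_double_count _ _ mu A (mulset A (invset A)) T _ (vol A) s hrad
    oA (mu_lty oA _ mA) oAA (mu_lty oAA _ mAA) oT finT oW' (ltW s0).
  rewrite -!/(vol _) => H.
  have {}H : vol A * vol A <= vol A * vol T + s * vol (mulset A (invset A)).
    apply: H => //.
    - move=> a Aa; rewrite -(mu_vol oA _ mA)// -(mu_invset oA).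
      rewrite -(mu_mull a (open_invset oA)); apply: le_measure; rewrite ?inE.
      + by apply: measurable_open; apply: open_mulset1l; exact: open_invset.
      + by apply: measurable_open; exact: (openI oAA (oWl a)).
      + move=> _ [_ -> [b' Ab <-]]; split; first exact: mulset_mem.
        by rewrite /= invgM mulgVK -invsetE.
    - by move=> y _ /negP; rewrite -leNgt.
  have : s * vol (mulset A (invset A)) <= vol A * vol A / 2.
    apply: le_trans (ler_wpM2l (ltW s0) AAq) _.
    by rewrite {2 3}sE {1}sE; lra.
  by move=> H2; nra.
(* Otherwise [s vol T <= (s / 4) vol A <= (s / 2) vol T], which is impossible since [T] has positive
   volume. *)
have [a Aa Da] : exists2 a, A a & s / 4 < vol [set y | T y /\ A (y^-1 * a)%g].
  apply: contrapT => nD.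
  have := @open_double_count _ _ mu T A set0 _ s (s / 4) hrad oT finT oA
    (mu_lty oA _ mA) open0 _ oW _.
  rewrite !measure0 -!/(vol _) => H.
  have {}H : s * vol T <= vol T * 0 + s / 4 * vol A.
    apply: H => //; first by rewrite divr_ge0// ltW.
      by move=> y Ty; exact: ltW.
    move=> a Aa _; rewrite leNgt; apply/negP => Da; apply: nD; exists a => //.
    rewrite -lte_fin -(mu_vol (B := mulset A (invset A)))//.
      exact: (openI oT (oWl a)).
    by move=> y [/TAA].
  by nra.
set D := [set y | _] in Da.
have oD : open D by exact: (openI oT (oWl a)).
have DAA : D `<=` mulset A (invset A) by move=> y [/TAA].
have oS : open S by exact: open_popular_translates.
have mAA' : multiplicative_set (mulset (invset A) A).
  by apply: multiplicative_mulset => //; exact: multiplicative_invset.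
have SAA : S `<=` mulset (invset A) A.
  by apply: popular_translates_sub; exact: ltW.
have := @open_double_count _ _ mu D A (mulset [set a] S) _ s t hrad oD
  (mu_lty oD DAA mAA) oA (mu_lty oA _ mA) (open_mulset1l a oS) _ oW (ltW t0).
rewrite mu_mull// -!/(vol _) => H.
have {}H : s * vol D <= vol D * vol S + t * vol A.
  apply: H => //; first exact: mu_lty SAA mAA'.
    by move=> y [Ty _]; exact: ltW.
  move=> c Ac nSc.
  have : ~ S (c^-1 * a)%g.
    move=> Sca; apply: nSc; exists a => //.
    exists (a^-1 * c)%g; last by rewrite mulVKg.
    by rewrite /S -popular_translatesV// invsetE invgM invgK.
  move=> /negP; rewrite -leNgt; apply: le_trans.
  (* With [e = y^-1 a], the fibre condition puts [e] and [e a^-1 c] in [A], that is, [e] in the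
     overlap for [c^-1 a]; inversion and left translation by [a] preserve measure. *)
  have oE := @open_translate_overlap A (c^-1 * a)%g oA.
  rewrite -(mu_invset oE) -(mu_mull a (open_invset oE)).
  apply: le_measure; rewrite ?inE.
  - by apply: measurable_open; exact: (openI oD (oWl c)).
  - by apply: measurable_open; apply: open_mulset1l; exact: open_invset.
  - move=> y [[_ Aya] /= Ayc]; rewrite mulset1l /= invsetE.
    rewrite invgM invgK; split => //=.
    by rewrite invgM invgK !mulgA mulgK.
have D0 : 0 < vol D by apply: le_lt_trans Da; rewrite divr_ge0// ltW.
(* This explains the 32 in [t]: as [vol D > s / 4], the error term is at most [vol D] times [s / 2],
   which leaves at least [s / 2] for [vol S]. *)
have tA : t * vol A = s / 4 * (s / 2).
  by rewrite tE sE; field; rewrite gt_eqF.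
have : s / 2 <= vol S.
  rewrite -(ler_pM2l D0); nra.
rewrite {1}sE; nra.
Qed.

(** * Measure comparisons and construction of the approximate group *)

Lemma geom_meanE A B : multiplicative_set A -> multiplicative_set B ->
  geom_mean mu A B = (Num.sqrt (vol A) * Num.sqrt (vol B))%:E.
Proof.
move=> mA mB; have [_ oA _] := mA; have [_ oB _] := mB.
rewrite /geom_mean (mu_vol oA _ mA)// (mu_vol oB _ mB)// !poweR_EFin -EFinM.
by rewrite !powR12_sqrt// ltW// vol_gt0.
Qed.

Lemma vol_mulset_fset_le (X : {fset G}) B : multiplicative_set B ->
  vol (mulset [set` X] B) <= #|` X|%:R * vol B.
Proof.
move=> mB; have [B0 oB _] := mB.
have muXB : (mu (mulset [set` X] B) <= (#|` X|%:R * vol B)%:E)%E.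
  rewrite EFinM -(mu_vol oB _ mB)// mule_natl.
  rewrite (_ : mulset [set` X] B = \big[setU/set0]_(x <- X) mulset [set x] B).
    elim: (enum_fset X) => [|x s IH]; first by rewrite big_nil measure0.
    rewrite big_cons muleS -{1}(mu_mull x oB).
    have mS : measurable
        (\big[setU/set0]_(y <- s) mulset [set y] B : set (borel G)).
      apply: bigsetU_measurable => y _; apply: measurable_open.
      exact: open_mulset1l.
    apply: le_trans (measureU2 _ _ mS) _.
      by apply: measurable_open; exact: open_mulset1l.
    exact: leeD.
  rewrite -bigcup_fset.
  apply/seteqP; split=> [_ [x Xx [b Bb <-]]|_ [x Xx [_ -> [b Bb <-]]]].
    by exists x => //; exact: mulset_mem.
  exact: mulset_mem.
rewrite -lee_fin /vol fineK// ge0_fin_numE//.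
by apply: le_lt_trans muXB _; rewrite ltry.
Qed.

Lemma vol_mulset_fsetr_le (X : {fset G}) B : multiplicative_set B ->
  vol (mulset B [set` X]) <= #|` X|%:R * vol B.
Proof.
move=> mB; have [_ oB _] := mB; have [Y [YE <-]] := inv_fset X.
rewrite -(vol_invset (open_mulsetl _ oB)) invset_mul -YE -(vol_invset oB).
by apply: vol_mulset_fset_le; exact: multiplicative_invset.
Qed.

(** With [q = k^2], covering [H H] requires control of [S^5], at the cost of five growth factors
    [32 q^3]; the bounds [vol (A A^-1) <= q vol A] and [vol A <= 4 q vol S] complete the power
    [q^17]. *)
Lemma approximate_group_of_small_product A B (k : R) :
  multiplicative_set A -> multiplicative_set B -> 0 < k ->
  vol (mulset A B) <= k * (Num.sqrt (vol A) * Num.sqrt (vol B)) ->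
  exists (H : set G) (X : {fset G}),
    [/\ approximate_group (8 * 32 ^+ 5 * (k ^+ 2) ^+ 17) H,
        vol H <= 32 ^+ 2 * (k ^+ 2) ^+ 8 * (Num.sqrt (vol A) * Num.sqrt (vol B)),
        #|` X|%:R <= 256 * (k ^+ 2) ^+ 6,
        A `<=` mulset [set` X] H
      & B `<=` mulset H [set` X]].
Proof.
move=> mA mB k0 ABk; have [A0 oA _] := mA; have [B0 oB _] := mB.
have eq_le (x y : R) : x = y -> x <= y by move=> ->.
have vA0 := vol_gt0 mA; have vB0 := vol_gt0 mB.
set a := Num.sqrt (vol A) in ABk *; set b := Num.sqrt (vol B) in ABk *.
have a0 : 0 < a by rewrite sqrtr_gt0.
have b0 : 0 < b by rewrite sqrtr_gt0.
have aE : vol A = a ^+ 2 by rewrite sqr_sqrtr// ltW.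
have bE : vol B = b ^+ 2 by rewrite sqr_sqrtr// ltW.
have mAB := multiplicative_mulset mA mB.
(* [A B] contains translates of [A] and of [B], so [a] and [b] agree up to a factor [k]; this also
   forces [k >= 1]. *)
have ab : a <= k * b.
  rewrite -(ler_pM2l a0) -expr2 -aE mulrCA; apply: le_trans ABk.
  exact: vol_le_mulr.
have ba : b <= k * a.
  rewrite -(ler_pM2r b0) -expr2 -bE -mulrA; apply: le_trans ABk.
  exact: vol_le_mull.
have mA' := multiplicative_invset mA; have mB' := multiplicative_invset mB.
have mAA := multiplicative_mulset mA mA'.
pose q := k ^+ 2; rewrite -/q.
have q1 : 1 <= q.
  rewrite -(ler_pM2r a0) mul1r /q expr2 -mulrA; apply: le_trans ab _.
  by rewrite ler_pM2l.
have k1 : 1 <= k by rewrite -(@expr_ge1 _ 2)// ltW.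
have kq : k <= q by rewrite /q expr2 ler_peMr// ltW.
have q0 : 0 < q by lra.
(* Triangle inequality through [B], where [B^-1 A^-1] is the inverse of [A B]. *)
have AAq : vol (mulset A (invset A)) <= q * vol A.
  have := ruzsa_triangle mA mB mA'.
  rewrite -invset_mul vol_invset; last exact: open_mulsetl.
  move=> /le_trans/(_ (ler_pM (vol_ge0 _) (vol_ge0 _) ABk ABk)) H.
  rewrite -(ler_pM2l vB0); apply: le_trans H _.
  by rewrite aE bE /q le_eqVlt; apply/orP; left; apply/eqP; ring.
pose t := vol A / (32 * q ^+ 2); pose S := popular_translates A t.
have t0 : 0 < t by rewrite divr_gt0// mulr_gt0// exprn_gt0.
have vAS : vol A <= 4 * q * vol S by exact: vol_popular_translates.
have oS : open S by exact: open_popular_translates.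
have SV : invset S = S by exact: popular_translatesV.
have mS : multiplicative_set S.
  apply: (@multiplicative_sub _ _ (mulset (invset A) A)) => //; last 2 first.
  - by apply: popular_translates_sub; exact: ltW.
  - exact: multiplicative_mulset.
  apply: contrapT => nS; have S0 : S = set0.
    by rewrite -subset0 => x Sx; apply: nS; exists x.
  by move: vAS; rewrite S0 /vol measure0 mulr0 leNgt vA0.
have [S0 _ _] := mS; have vS0 := vol_gt0 mS.
(* One growth step costs a factor [q vol A / t], which is [32 q^3]. *)
pose g := 32 * q ^+ 3; have g0 : 0 <= g by rewrite mulr_ge0// exprn_ge0// ltW.
have growth n : multiplicative_set (iter n (fun Y => mulset Y S) A) /\
    vol (mulset (iter n (fun Y => mulset Y S) A) (invset A)) <=
    g ^+ n * (q * vol A).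
  elim: n => [|n [mY IH]]; first by rewrite expr0 mul1r.
  split; first exact: multiplicative_mulset.
  have := popular_translates_growth (ltW t0) mA mA' mY mS.
  move=> /le_trans/(_ (ler_pM (vol_ge0 _) (vol_ge0 _) IH AAq)) H.
  rewrite -(ler_pM2l t0); apply: le_trans H _.
  apply: eq_le; rewrite (exprS g n).
  move: (g ^+ n) => gn; rewrite /t /g.
  by field; rewrite gt_eqF.
(* This discards the outer [A] and [A^-1] from the growth bounds. *)
have vol_sandwich Z : multiplicative_set Z ->
    vol Z <= vol (mulset (mulset A Z) (invset A)).
  move=> mZ; have [_ oZ _] := mZ; have mAZ := multiplicative_mulset mA mZ.
  have [_ oAZ _] := mAZ; apply: (@le_trans _ _ (vol (mulset A Z))).
    exact: vol_le_mull.
  by apply: vol_le_mulr; [case: mA'| |exact: multiplicative_mulset].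
have mH := multiplicative_mulset mS mS; have [_ oH _] := mH.
have HV : invset (mulset S S) = mulset S S by rewrite invset_mul SV.
have mHH := multiplicative_mulset mH mH.
have [X0 [X0H cX0 HX0]] : exists X : {fset G},
    [/\ [set` X] `<=` mulset (mulset S S) (mulset S S),
       (#|` X|%:R : R) <= 4 * 32 ^+ 5 * q ^+ 17
     & mulset (mulset S S) (mulset S S) `<=`
       mulset [set` X] (mulset S (invset S))].
  apply: ruzsa_covering => //.
  apply: le_trans (vol_sandwich _ (multiplicative_mulset mHH mS)) _.
  have [_] := growth 5; rewrite /= !mulsetA => /le_trans; apply.
  apply: le_trans (ler_wpM2l (exprn_ge0 _ g0) (ler_wpM2l (ltW q0) vAS)) _.
  by apply: eq_le; rewrite /g; ring.
have [X1 [_ cX1 AX1]] : exists X : {fset G}, [/\ [set` X] `<=` A,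
    (#|` X|%:R : R) <= 128 * q ^+ 5
    & A `<=` mulset [set` X] (mulset S (invset S))].
  apply: ruzsa_covering => //.
  apply: (@le_trans _ _ (g ^+ 1 * (q * vol A))).
    have [mAS] := growth 1; apply: le_trans; have [_ oAS _] := mAS.
    by apply: vol_le_mulr => //; [case: mA'|exact: multiplicative_mulset].
  apply: le_trans (ler_wpM2l (exprn_ge0 _ g0) (ler_wpM2l (ltW q0) vAS)) _.
  by apply: eq_le; rewrite /g; ring.
(* [B] must be covered from the right, so [B^-1] is covered from the left and the result inverted.
   The volume of [S B] is bounded by the triangle inequality through [A^-1]. *)
have [X2 [_ cX2 BX2]] : exists X : {fset G}, [/\ [set` X] `<=` invset B,
    (#|` X|%:R : R) <= 128 * q ^+ 6
    & invset B `<=` mulset [set` X] (mulset S (invset S))].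
  apply: ruzsa_covering => //.
  rewrite -{1}SV -invset_mul vol_invset; last exact: open_mulsetr.
  rewrite -(ler_pM2l vA0) -{1}(vol_invset oA).
  apply: le_trans (ruzsa_triangle mS mA' mB) _; rewrite invsetK.
  have SA : vol (mulset S (invset A)) <= g * (q * vol A).
    have [mAS] := growth 1; rewrite expr1; apply: le_trans; rewrite /= -mulsetA.
    apply: vol_le_mull => //; first by apply: open_mulsetl.
    by rewrite mulsetA; exact: multiplicative_mulset.
  have ABA : vol (mulset A B) <= q * vol A.
    apply: le_trans ABk _; rewrite aE /q.
    have := ler_wpM2l (ltW a0) ba.
    by move=> /(ler_wpM2l (ltW k0)) /le_trans; apply; apply: eq_le; ring.
  apply: le_trans (ler_pM (vol_ge0 _) (vol_ge0 _) SA ABA) _.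
  rewrite (_ : g * _ * _ = vol A * (g * q ^+ 2 * vol A)); last by ring.
  rewrite ler_pM2l//; apply: le_trans (ler_wpM2l _ vAS) _.
    by rewrite mulr_ge0// exprn_ge0// ltW.
  by apply: eq_le; rewrite /g; ring.
(* Symmetrising doubles the cardinality, whence 8 in place of 4. *)
have [Y [YV XY cY YZ]] := symmetric_fset X0.
have [X3 [X3E cX3]] := inv_fset X2.
rewrite SV in HX0 AX1 BX2.
exists (mulset S S), (X1 `|` X3)%fset; split.
- split => //; exists Y; split => //.
  + by apply: YZ => //; rewrite invset_mul HV.
  + apply: (@le_trans _ _ (2 * #|` X0|%:R)); first by rewrite -natrM ler_nat.
    rewrite (_ : 8 * _ * _ = 2 * (4 * 32 ^+ 5 * q ^+ 17)); last by ring.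
    by rewrite ler_pM2l.
  + by apply: subset_trans HX0 _; exact: mulset_sub.
- apply: le_trans (vol_sandwich _ mH) _.
  have [_] := growth 2; rewrite /= !mulsetA => /le_trans; apply.
  rewrite (_ : g ^+ _ * _ = 32 ^+ 2 * q ^+ 7 * (a * a)); last first.
    by rewrite aE /g; ring.
  have H : a * a <= q * (a * b).
    rewrite mulrCA ler_pM2l//; apply: le_trans ab _.
    by rewrite ler_pM2r.
  apply: le_trans (ler_wpM2l _ H) _; first by rewrite mulr_ge0// exprn_ge0// ltW.
  by apply: eq_le; ring.
- rewrite (le_trans (card_fsetU_le cX1 (s := 128 * q ^+ 6) _))// ?cX3//.
  have : q ^+ 5 <= q ^+ 6 by rewrite ler_weXn2l.
  lra.
- apply: subset_trans AX1 _; apply: mulset_sub => //.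
  by rewrite set_fsetU => x; left.
- have : mulset (mulset S S) [set` X3] `<=`
      mulset (mulset S S) [set` (X1 `|` X3)%fset].
    by apply: mulset_sub => //; rewrite set_fsetU => x; right.
  apply: subset_trans; rewrite X3E -HV -invset_mul => x Bx.
  by rewrite invsetE; apply: BX2; rewrite invsetE invgK.
Qed.

(** * Real-valued forms of the conditions, and the converse volume bound *)

Lemma mu_mulset_le A B (r : R) : multiplicative_set A -> multiplicative_set B ->
  (mu (mulset A B) <= r%:E * geom_mean mu A B)%E =
  (vol (mulset A B) <= r * (Num.sqrt (vol A) * Num.sqrt (vol B))).
Proof.
move=> mA mB; have mAB := multiplicative_mulset mA mB; have [_ oAB _] := mAB.
by rewrite (mu_vol oAB _ mAB)// geom_meanE// -EFinM lee_fin.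
Qed.

Lemma ruzsa_distance_invset A B : multiplicative_set A -> multiplicative_set B ->
  ruzsa_distance mu A (invset B) =
  (ln (vol (mulset A B) / (Num.sqrt (vol A) * Num.sqrt (vol B))))%:E.
Proof.
move=> mA mB; have mAB := multiplicative_mulset mA mB; have [_ oAB _] := mAB.
have [_ oB _] := mB.
have mB' := multiplicative_invset mB.
rewrite /ruzsa_distance invsetK geom_meanE//.
rewrite vol_invset// (mu_vol oAB _ mAB)//.
have g0 : 0 < Num.sqrt (vol A) * Num.sqrt (vol B).
  by rewrite mulr_gt0// sqrtr_gt0 vol_gt0.
rewrite inver gt_eqF// -EFinM lne_EFin// divr_gt0//; exact: vol_gt0.
Qed.

Lemma multiplicative_mulset_fset (X : {fset G}) B : [set` X] !=set0 ->
  multiplicative_set B -> multiplicative_set (mulset [set` X] B).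
Proof.
move=> X0; apply: multiplicative_mulset_compact => //; exact: compact_fset.
Qed.

Lemma multiplicative_mulset_fsetr (X : {fset G}) B : [set` X] !=set0 ->
  multiplicative_set B -> multiplicative_set (mulset B [set` X]).
Proof.
move=> [x Xx] mB; have [Y [YE _]] := inv_fset X.
rewrite -[mulset _ _]invsetK invset_mul -YE.
apply: multiplicative_invset; apply: multiplicative_mulset_fset.
  by exists x^-1%g; rewrite YE invsetE invgK.
exact: multiplicative_invset.
Qed.

(** [A B] lies in [X H H X], hence in [X Y H X], and each finite factor costs its cardinality. Since
    [A] and [H] are non-empty, so are [X] and [Y], which keeps the intermediate products
    multiplicative sets. *)
Lemma vol_mulset_of_cover A B H (X : {fset G}) (M : R) :
  multiplicative_set A -> multiplicative_set B -> approximate_group M H ->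
  A `<=` mulset [set` X] H -> B `<=` mulset H [set` X] ->
  vol (mulset A B) <= #|` X|%:R * (#|` X|%:R * (M * vol H)).
Proof.
move=> mA mB [mH _ [Y [_ _ YM HHY]]] AX BX.
have [[a Aa] oA _] := mA; have [[h Hh] oH _] := mH.
have X0 : [set` X] !=set0 by case: (AX _ Aa) => x Xx _; exists x.
have Y0 : [set` Y] !=set0.
  by case: (HHY _ (mulset_mem Hh Hh)) => y Yy _; exists y.
have mYH := multiplicative_mulset_fset Y0 mH.
have mXYH := multiplicative_mulset_fset X0 mYH.
apply: (@le_trans _ _
  (vol (mulset (mulset [set` X] (mulset [set` Y] H)) [set` X]))).
  apply: vol_le; [exact: open_mulsetl| |exact: multiplicative_mulset_fsetr].
  apply: subset_trans (mulset_sub AX BX) _.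
  rewrite mulsetA; apply: mulset_sub => //; rewrite -mulsetA.
  exact: mulset_sub.
apply: le_trans (vol_mulset_fsetr_le _ mXYH) _.
apply: ler_wpM2l => //; apply: le_trans (vol_mulset_fset_le _ mYH) _.
apply: ler_wpM2l => //; apply: le_trans (vol_mulset_fset_le _ mH) _.
by apply: ler_wpM2r => //; exact: vol_ge0.
Qed.

End MultiplicativeGroupVolume.

(** * Absorbing constants *)

Lemma approximate_group_le (R : realType) (G : topologicalGroupType) (K K' : R)
    (H : set G) :
  K <= K' -> approximate_group K H -> approximate_group K' H.
Proof.
move=> KK' [mH HV [X [XV XH cX HX]]]; split => //; exists X; split => //.
exact: le_trans KK'.
Qed.

(** A bound [C K^C] has one constant as coefficient and exponent; [a + e] can be both because
    [K >= 1]. *)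
Lemma powR_monomial_le (R : realType) (a e K : R) : 0 < a -> 0 <= e -> 1 <= K ->
  a * K `^ e <= (a + e) * K `^ (a + e).
Proof.
move=> a0 e0 K1; apply: ler_pM; [exact: ltW|exact: powR_ge0|by rewrite lerDl|].
by apply: ler_powR => //; rewrite lerDr ltW.
Qed.

Lemma powR_power_le (R : realType) (c C : R) (n : nat) : 0 < c -> 0 < C ->
  exists2 C1 : R, 0 < C1 & forall K, 1 <= K ->
    c * ((C * K `^ C) ^+ 2) ^+ n <= C1 * K `^ C1.
Proof.
move=> c0 C0; exists (c * C ^+ (2 * n) + C * (2 * n)%:R).
  by rewrite ltr_wpDr ?mulr_ge0 ?mulr_gt0 ?exprn_gt0// ltW.
move=> K K1; apply: le_trans (powR_monomial_le _ _ K1).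
- by rewrite -exprM exprMn -(powR_mulrn _ (powR_ge0 K C)) -powRrM mulrA.
- by rewrite mulr_gt0 ?exprn_gt0.
- by rewrite mulr_ge0// ltW.
Qed.

Theorem theorem4p6 (R : realType) :
  [/\ (* (i) implies (ii) *)
      (forall C : R, 0 < C ->
         exists C1 C2 C3 : R, [/\ 0 < C1, 0 < C2, 0 < C3 &
           forall (G : topologicalGroupType)
                  (mu : {measure set (borel G) -> \bar R})
                  (K : R) (A B : set G),
             multiplicative_group mu -> 1 <= K ->
             multiplicative_set A -> multiplicative_set B ->
             small_product mu K A B C ->
             approximate_group_control mu K A B C1 C2 C3]),
      (* (ii) implies (i) *)
      (forall C1 C2 C3 : R, 0 < C1 -> 0 < C2 -> 0 < C3 ->
         exists2 C : R, 0 < C &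
           forall (G : topologicalGroupType)
                  (mu : {measure set (borel G) -> \bar R})
                  (K : R) (A B : set G),
             multiplicative_group mu -> 1 <= K ->
             multiplicative_set A -> multiplicative_set B ->
             approximate_group_control mu K A B C1 C2 C3 ->
             small_product mu K A B C),
      (* the two forms of (i) are equivalent *)
      (forall C : R, 0 < C ->
         exists2 C' : R, 0 < C' &
           forall (G : topologicalGroupType)
                  (mu : {measure set (borel G) -> \bar R})
                  (K : R) (A B : set G),
             multiplicative_group mu -> 1 <= K ->
             multiplicative_set A -> multiplicative_set B ->
             small_product mu K A B C ->
             small_distance mu K A B C')
    & (forall C : R, 0 < C ->
         exists2 C' : R, 0 < C' &
           forall (G : topologicalGroupType)
                  (mu : {measure set (borel G) -> \bar R})
                  (K : R) (A B : set G),
             multiplicative_group mu -> 1 <= K ->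
             multiplicative_set A -> multiplicative_set B ->
             small_distance mu K A B C ->
             small_product mu K A B C')].
Proof.
split.
- move=> C C0.
  (* 17, 8 and 6 are the powers of [k^2] in the construction, applied with [k = C K^C]. *)
  have [C1 C10 C1P] := @powR_power_le R (8 * 32 ^+ 5) C 17 ltac:(by []) C0.
  have [C2 C20 C2P] := @powR_power_le R (32 ^+ 2) C 8 ltac:(by []) C0.
  have [C3 C30 C3P] := @powR_power_le R 256 C 6 ltac:(by []) C0.
  exists C1, C2, C3; split => // G mu K A B hmu K1 mA mB.
  rewrite /small_product (mu_mulset_le hmu)// => AB.
  have k0 : 0 < C * K `^ C.
    by rewrite mulr_gt0// powR_gt0// (lt_le_trans _ K1).
  have [H [X [aH muH cX AX BX]]] :=
    approximate_group_of_small_product hmu mA mB k0 AB.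
  exists H, X; split => //.
  + exact: approximate_group_le (C1P _ K1) aH.
  + have [mH _ _] := aH; have [_ oH _] := mH.
    rewrite (geom_meanE hmu)// (mu_vol hmu oH _ mH)// -EFinM lee_fin.
    apply: le_trans muH _; apply: ler_wpM2r; last exact: C2P.
    by rewrite mulr_ge0// sqrtr_ge0.
  + by apply: le_trans cX _; exact: C3P.
- move=> C1 C2 C3 C10 C20 C30.
  (* [X] occurs on both sides of [X H H X], so [C3] counts twice. *)
  pose a := C3 * C3 * C1 * C2; pose e := C3 + C3 + C1 + C2.
  have a0 : 0 < a by rewrite !mulr_gt0.
  have e0 : 0 < e by rewrite !addr_gt0.
  exists (a + e) => [|G mu K A B hmu K1 mA mB]; first exact: addr_gt0.
  move=> [H [X [aH muH cX AX BX]]].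
  have [mH _ _] := aH; have [_ oH _] := mH.
  rewrite /small_product (mu_mulset_le hmu)//.
  apply: le_trans (vol_mulset_of_cover hmu mA mB aH AX BX) _.
  move: muH; rewrite (geom_meanE hmu)// (mu_vol hmu oH _ mH)// -EFinM lee_fin.
  set g := Num.sqrt _ * _ => muH.
  have g0 : 0 <= g by rewrite mulr_ge0// sqrtr_ge0.
  apply: (@le_trans _ _ (a * K `^ e * g)); last first.
    by apply: ler_wpM2r => //; apply: powR_monomial_le => //; exact: ltW.
  have K0 : 0 < K by rewrite (lt_le_trans _ K1).
  rewrite (_ : a * _ * g = (C3 * K `^ C3) *
      ((C3 * K `^ C3) * ((C1 * K `^ C1) * (C2 * K `^ C2 * g)))); last first.
    by rewrite /a /e !powRD ?(gt_eqF K0) ?implybT//; ring.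
  have P0 x : 0 < x -> 0 <= x * K `^ x.
    by move=> x0; rewrite mulr_ge0 ?powR_ge0// ltW.
  have vH0 := vol_ge0 mu H.
  have C1H : 0 <= C1 * K `^ C1 * vol mu H by apply: mulr_ge0 => //; exact: P0.
  apply: ler_pM => //; first exact: mulr_ge0.
  apply: ler_pM => //.
  by apply: ler_wpM2l => //; exact: P0.
(* [ln (C K^C)] equals [ln C + C ln K], and the absolute value covers [C < 1], where [ln C] is
   negative. *)
- move=> C C0; exists (C + `|ln C|) => [|G mu K A B hmu K1 mA mB].
    by rewrite ltr_wpDr.
  rewrite /small_product /small_distance (mu_mulset_le hmu)//.
  rewrite (ruzsa_distance_invset hmu)// lee_fin.
  set g := Num.sqrt _ * _ => ABg.
  have vA := vol_gt0 hmu mA; have vB := vol_gt0 hmu mB.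
  have vAB := vol_gt0 hmu (multiplicative_mulset mA mB).
  have g0 : 0 < g by rewrite mulr_gt0// sqrtr_gt0.
  have K0 : 0 < K by rewrite (lt_le_trans _ K1).
  have KC0 : 0 < K `^ C by rewrite powR_gt0.
  apply: (@le_trans _ _ (ln (C * K `^ C))).
    rewrite ler_ln ?posrE; [by rewrite ler_pdivrMr|exact: divr_gt0|].
    exact: mulr_gt0.
  rewrite lnM ?posrE// ln_powR.
  have lnK : 0 <= ln K by rewrite ln_ge0.
  have := ler_norm (ln C); have := normr_ge0 (ln C); nra.
(* Exponentiating [C (1 + ln K)] gives [e^C K^C], and [C <= e^C] lets [e^C] be the exponent too. *)
- move=> C C0; exists (expR C) => [|G mu K A B hmu K1 mA mB].
    exact: expR_gt0.
  rewrite /small_product /small_distance (mu_mulset_le hmu)//.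
  rewrite (ruzsa_distance_invset hmu)// lee_fin.
  set g := Num.sqrt _ * _ => ABg.
  have vA := vol_gt0 hmu mA; have vB := vol_gt0 hmu mB.
  have vAB := vol_gt0 hmu (multiplicative_mulset mA mB).
  have g0 : 0 < g by rewrite mulr_gt0// sqrtr_gt0.
  have K0 : 0 < K by rewrite (lt_le_trans _ K1).
  rewrite -ler_pdivrMr// -[leLHS]lnK ?posrE ?divr_gt0//.
  apply: (@le_trans _ _ (expR C * K `^ C)).
    rewrite -{1}(lnK (x := K)) ?posrE// -expRM -expRD ler_expR.
    by rewrite (le_trans ABg)// mulrDr mulr1 (mulrC C).
  apply: ler_wpM2l; first exact: expR_ge0.
  by apply: ler_powR => //; apply: le_trans (expR_ge1Dx _); rewrite lerDr.
Qed.
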